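(* The category of simple $(X,M)$-graphs is the category of $\neg\neg$-separated $(X,M)$-graphs, and the category of simple reflexive $(X,M)$-graphs is the category of $\neg\neg$-separated reflexive $(X,M)$-graphs.
   Context: For a monoid $M$ and a right $M$-set $X$, the theory $\mathbb{G}_{(X,M)}$ is the category with two objects $V,A$, with $\mathrm{Hom}(V,A)=X$, $\mathrm{Hom}(A,V)=\emptyset$, $\mathrm{Hom}(V,V)=\{\mathrm{id}_V\}$, $\mathrm{Hom}(A,A)=M$, and composition $m\circ x=x.m$, $m\circ m'=m'm$. $(X,M)$-graphs are presheaves (of sets) on $\mathbb{G}_{(X,M)}$. Reflexive case: let $M$ be a monoid such that $\mathrm{Fix}(M)=\{m'\in M: mm'=m'\ \text{for all } m\in M\}$ is nonempty, and let $X=\{x_{m'}: m'\in\mathrm{Fix}(M)\}$ with right action $x_{m'}.m=x_{m'm}$. The theory $\mathrm{r}\mathbb{G}_{(X,M)}$ is obtained from $\mathbb{G}_{(X,M)}$ by setting instead $\mathrm{Hom}(A,V)=\{\ell\}$, with $\ell\circ m=\ell$, $\ell\circ x_{m'}=\mathrm{id}_V$, $x_{m'}\circ\ell=m'$ for $m\in M$, $m'\in\mathrm{Fix}(M)$. Reflexive $(X,M)$-graphs are presheaves on $\mathrm{r}\mathbb{G}_{(X,M)}$. For a (reflexive) $(X,M)$-graph $G$, an arc $\alpha\in G(A)$ and $x\in X$, write $\alpha.x=G(x)(\alpha)\in G(V)$; $\alpha$ is incident with a family $(v_x)_{x\in X}$ of vertices if $\alpha.x=v_x$ for all $x\in X$.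 $G$ is simple if for any family $(v_x)_{x\in X}$ of vertices of $G$ (multiplicities allowed) there is at most one arc incident with $(v_x)_{x\in X}$. The double negation topology is the Lawvere–Tierney topology $\neg\neg:\Omega\to\Omega$ on the presheaf topos (equivalently, the corresponding Grothendieck topology on the theory), and $\neg\neg$-separated means separated for this topology. The categories of simple, resp. separated, objects are full subcategories of the presheaf category.
   Formalization: For non-reflexive (X,M)-graphs, X is assumed nonempty; for X empty the claim fails for every M (two arcs with trivial M-action form a ¬¬-separated graph that is not simple). *)

(* Defs.v *)
From HB Require Import structures.
From mathcomp Require Import all_boot boolp.

Set Implicit Arguments.
Unset Strict Implicit.
Unset Printing Implicit Defensive.

Local Open Scope group_scope.

(* [comp g f] is the composite g o f: first f, then g. *)
Record category := Category {
  ob :> Type;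
  hom : ob -> ob -> Type;
  idm : forall a, hom a a;
  comp : forall a b c, hom b c -> hom a b -> hom a c;
  comp_idl : forall a b (f : hom a b), comp (idm b) f = f;
  comp_idr : forall a b (f : hom a b), comp f (idm a) = f;
  comp_assoc : forall a b c d (h : hom c d) (g : hom b c) (f : hom a b),
    comp (comp h g) f = comp h (comp g f) }.

Arguments hom {_} _ _.
Arguments idm {_} _.
Arguments comp {_ _ _ _} _ _.

Record subcategory (C : category) := Subcategory {
  sub_ob : C -> Prop;
  sub_hom : forall a b : C, hom a b -> Prop;
  sub_dom : forall a b (f : hom a b), sub_hom f -> sub_ob a;
  sub_cod : forall a b (f : hom a b), sub_hom f -> sub_ob b;
  sub_id : forall a, sub_ob a -> sub_hom (idm a);
  sub_comp : forall a b c (g : hom b c) (f : hom a b),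
    sub_hom g -> sub_hom f -> sub_hom (comp g f) }.

Definition full_subcategory (C : category) (P : C -> Prop) : subcategory C.
Proof.
refine (@Subcategory C P (fun a b _ => P a /\ P b) _ _ _ _).
- by move=> a b _ [].
- by move=> a b _ [].
- by [].
- by move=> a b c _ _ [_ Pc] [Pa _].
Defined.

Section Presheaves.
Variable C : category.

(* [restr f s] is the restriction s.f of s along f. *)
Record presheaf := Presheaf {
  sections :> C -> Type;
  restr : forall a b : C, hom a b -> sections b -> sections a;
  restr_id : forall a (s : sections a), restr (idm a) s = s;
  restr_comp : forall a b c (g : hom b c) (f : hom a b) (s : sections c),
    restr (comp g f) s = restr f (restr g s) }.

Record nat_trans (F G : presheaf) := NatTrans {
  component :> forall a : C, F a -> G a;
  naturality : forall a b (f : hom a b) (s : F b),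
    component (restr f s) = restr f (component s) }.

Lemma nat_trans_ext (F G : presheaf) (t u : nat_trans F G) :
  (forall a (s : F a), t a s = u a s) -> t = u.
Proof.
case: t u => [t tN] [u uN] /= tu.
have {}tu : t = u.
  by apply: functional_extensionality_dep => a; apply/funext => s.
by case: u / tu uN => uN; congr NatTrans; apply: Prop_irrelevance.
Qed.

Definition nat_id (F : presheaf) : nat_trans F F :=
  @NatTrans F F (fun _ s => s) (fun _ _ _ _ => erefl).

Definition nat_comp (F G H : presheaf) (u : nat_trans G H) (t : nat_trans F G) :
  nat_trans F H.
Proof.
refine (@NatTrans F H (fun a s => u a (t a s)) _).
by move=> a b f s; rewrite !naturality.
Defined.

Definition presheaf_category : category.
Proof.
refine (@Category presheaf nat_trans nat_id nat_comp _ _ _).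
- by move=> F G t; apply: nat_trans_ext.
- by move=> F G t; apply: nat_trans_ext.
- by move=> F G H K v u t; apply: nat_trans_ext.
Defined.

Record sieve (c : C) := Sieve {
  insieve :> forall d : C, hom d c -> Prop;
  sieve_closed : forall d e (f : hom d c) (g : hom e d),
    insieve f -> insieve (comp f g) }.

Definition maximal (c : C) (S : sieve c) : Prop :=
  forall d (f : hom d c), S d f.

Definition sieve_pullback (c b : C) (h : hom b c) (S : sieve c) : sieve b.
Proof.
refine (@Sieve b (fun d f => S d (comp h f)) _).
by move=> d e f g Sf; rewrite -comp_assoc; apply: sieve_closed.
Defined.

Record grothendieck_topology := GrothendieckTopology {
  covers :> forall c : C, sieve c -> Prop;
  covers_max : forall c (S : sieve c), maximal S -> covers S;
  covers_pullback : forall (c b : C) (h : hom b c) (S : sieve c),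
    covers S -> covers (sieve_pullback h S);
  covers_trans : forall c (S R : sieve c), covers S ->
    (forall d (f : hom d c), S d f -> covers (sieve_pullback f R)) ->
    covers R }.

(* The component at c of the negation of the Heyting algebra object Omega,
   where Omega(c) is the set of sieves on c. *)
Definition sieve_neg (c : C) (S : sieve c) : sieve c.
Proof.
refine (@Sieve c (fun d f => forall e (g : hom e d), ~ S e (comp f g)) _).
by move=> d e f g Sf k h; rewrite comp_assoc; apply: Sf.
Defined.

(* The Grothendieck topology J associated with a Lawvere-Tierney topology
   j : Omega -> Omega is given by: S is in J(c) iff j_c(S) is the maximal
   sieve.  Here j is double negation. *)
Definition negneg_topology : grothendieck_topology.
Proof.
refine (@GrothendieckTopology
  (fun c S => maximal (sieve_neg (sieve_neg S))) _ _ _).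
- by move=> c S Smax d f e g nS; apply: (nS e (idm e)); apply: Smax.
- move=> c b h S Scov d f e g nS; apply: (Scov d (comp h f) e g) => k l Skl.
  by apply: (nS k l); rewrite /= -!comp_assoc.
- move=> c S R Scov SR d f e g nR; apply: (Scov d f e g) => k l Sl.
  apply: (SR _ _ Sl k (idm k) k (idm k)) => m n /=.
  rewrite !comp_idl => Rn; apply: (nR m (comp l n)).
  by rewrite -comp_assoc.
Defined.

Record matching_family (F : presheaf) (c : C) (S : sieve c) := MatchingFamily {
  member : forall d (f : hom d c), S d f -> F d;
  member_compat : forall d e (f : hom d c) (g : hom e d)
    (Sf : S d f) (Sfg : S e (comp f g)), member Sfg = restr g (member Sf) }.

Definition amalgamation (F : presheaf) (c : C) (S : sieve c)
    (p : matching_family F S) (s : F c) : Prop :=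
  forall d (f : hom d c) (Sf : S d f), restr f s = member p Sf.

Definition separated (J : grothendieck_topology) (F : presheaf) : Prop :=
  forall c (S : sieve c), J c S ->
  forall (p : matching_family F S) (s t : F c),
    amalgamation p s -> amalgamation p t -> s = t.

End Presheaves.

Record right_mset (M : monoidType) := RightMSet {
  mset_carrier :> Type;
  mact : mset_carrier -> M -> mset_carrier;
  mact1 : forall x, mact x 1 = x;
  mactM : forall x m n, mact x (m * n) = mact (mact x m) n }.

Inductive theory_ob := V | A.

Section GraphTheory.
Variables (M : monoidType) (X : right_mset M).

Definition theory_hom (a b : theory_ob) : Type :=
  match a, b with
  | V, V => unit
  | V, A => X
  | A, V => void
  | A, A => M
  end.

Definition theory_id (a : theory_ob) : theory_hom a a :=
  match a with V => tt | A => 1 end.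

Definition theory_comp (a b c : theory_ob) :
    theory_hom b c -> theory_hom a b -> theory_hom a c :=
  match a, b, c with
  | V, V, V => fun _ _ => tt
  | V, V, A => fun x _ => x
  | V, A, V => fun l _ => of_void _ l
  | V, A, A => fun m x => mact x m
  | A, V, V => fun _ l => l
  | A, V, A => fun _ l => of_void _ l
  | A, A, V => fun l _ => l
  | A, A, A => fun m m' => m' * m
  end.

Definition theory : category.
Proof.
refine (@Category theory_ob theory_hom theory_id theory_comp _ _ _).
- case=> [] [] //=; [by case|exact: mact1|exact: mulg1].
- case=> [] [] //=; [by case|exact: mul1g].
- case=> [] [] [] [] //= h g f; try by case: (h); try by case: (g);
    try by case: (f).
  + by rewrite mactM.
  + by rewrite mulgA.
Defined.

End GraphTheory.

Section ReflexiveGraphTheory.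
Variable M : monoidType.

Definition Fix (m' : M) : Prop := forall m : M, m * m' = m'.

Lemma Fix_mulr m' m : Fix m' -> Fix (m' * m).
Proof. by move=> Fm' n; rewrite mulgA Fm'. Qed.

(* The element x_{m'} is the pair of m' and the proof that it is in Fix(M). *)
Definition fix_act (x : {m' : M | Fix m'}) (m : M) : {m' : M | Fix m'} :=
  exist _ (sval x * m) (Fix_mulr m (svalP x)).

Lemma fix_ext (x y : {m' : M | Fix m'}) : sval x = sval y -> x = y.
Proof.
case: x y => [x Fx] [y Fy] /= xy; case: y / xy Fy => Fy.
by congr exist; apply: Prop_irrelevance.
Qed.

Definition fix_mset : right_mset M.
Proof.
refine (@RightMSet M {m' : M | Fix m'} fix_act _ _).
- by move=> x; apply: fix_ext; rewrite /= mulg1.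
- by move=> x m n; apply: fix_ext; rewrite /= mulgA.
Defined.

Definition rtheory_hom (a b : theory_ob) : Type :=
  match a, b with
  | V, V => unit
  | V, A => fix_mset
  | A, V => unit
  | A, A => M
  end.

Definition rtheory_id (a : theory_ob) : rtheory_hom a a :=
  match a with V => tt | A => 1 end.

(* The element of [rtheory_hom A V] is the arrow l. *)
Definition rtheory_comp (a b c : theory_ob) :
    rtheory_hom b c -> rtheory_hom a b -> rtheory_hom a c :=
  match a, b, c with
  | V, V, V => fun _ _ => tt
  | V, V, A => fun x _ => x
  | V, A, V => fun _ _ => tt
  | V, A, A => fun m x => mact x m
  | A, V, V => fun _ _ => tt
  | A, V, A => fun x _ => sval x
  | A, A, V => fun _ _ => tt
  | A, A, A => fun m m' => m' * m
  end.

Definition rtheory : category.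
Proof.
refine (@Category theory_ob rtheory_hom rtheory_id rtheory_comp _ _ _).
- case=> [] [] //=; [by case|exact: (@mact1 M fix_mset)|by case|exact: mulg1].
- case=> [] [] //=; [by case|by case|exact: mul1g].
- case=> [] [] [] [] //= h g f; try by rewrite ?mulgA.
  + by apply: fix_ext; rewrite /= (svalP h).
  + by apply: fix_ext; rewrite /= mulgA.
  + by rewrite (svalP h).
Defined.

End ReflexiveGraphTheory.

(* Here [arr] is the family of arrows from the vertex object v to the arc object
   a indexed by X, so that alpha.x is [restr (arr x) alpha]. *)
Definition incident (C : category) (v a : C) (X : Type) (arr : X -> hom v a)
    (G : presheaf C) (alpha : G a) (vx : X -> G v) : Prop :=
  forall x, restr (arr x) alpha = vx x.

Definition simple (C : category) (v a : C) (X : Type) (arr : X -> hom v a)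
    (G : presheaf C) : Prop :=
  forall (vx : X -> G v) (alpha beta : G a),
    incident arr alpha vx -> incident arr beta vx -> alpha = beta.

Definition simple_graph (M : monoidType) (X : right_mset M) :
    presheaf (theory X) -> Prop :=
  @simple (theory X) V A X (fun x => x).

Definition simple_rgraph (M : monoidType) : presheaf (rtheory M) -> Prop :=
  @simple (rtheory M) V A (fix_mset M) (fun x => x).

(* Main.v *)
Require Import Defs.
From mathcomp Require Import all_boot boolp.

(** Both theories have an object [V] with two properties: every object receives
    an arrow from [V], and every arrow into [V] has a section.  In the plain
    theory the only arrow into [V] is the identity; in the reflexive theory the
    additional arrow l is split by each x_m'.

    These two properties determine the double negation topology.  A sieve S is
    dense when each arrow f extends to some [f o g] in S.  If f starts at [V],
    such a g has a section h, so f = f o g o h already belongs to S; conversely,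
    if S contains all arrows from [V], then any f : d -> c can be extended into S
    by an arrow [V -> d].  So the covering sieves are those containing all
    arrows from [V] ([negneg_coverP]); the least one consists of the arrows that
    factor through [V].  Therefore a presheaf is separated iff its sections are
    determined by their restrictions along arrows from [V] ([separatedP]).

    This condition is automatic at [V] because of the identity.  At [A], where
    the arrows from [V] are the elements of X, it says that an arc is determined
    by its family of incident vertices, which is simplicity
    ([simple_separatedP]).  Full subcategories are determined by their predicate
    on objects, so the equivalence of the predicates yields the equality of
    subcategories. *)

Set Implicit Arguments.
Unset Strict Implicit.
Unset Printing Implicit Defensive.

(** The vertex family in the definition of simplicity can be taken to be the
    one of either arc, so only the comparison of the two arcs remains. *)
Lemma simpleP (C : category) (v a : C) (X : Type) (arr : X -> hom v a)
    (G : presheaf C) :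
  simple arr G <->
  forall s t : G a,
    (forall x, restr (arr x) s = restr (arr x) t) -> s = t.
Proof.
split=> [Gs s t st|Gi vx s t sv tv].
  by apply: (Gs (fun x => restr (arr x) t)).
by apply: Gi => x; rewrite sv tv.
Qed.

Section SplitGenerator.
Variables (C : category) (v : C).
Hypothesis arrow_from_v : forall d : C, inhabited (hom v d).
Hypothesis split_into_v : forall (d : C) (g : hom d v),
  exists h : hom v d, Defs.comp g h = idm v.

(** Density forces each x : v -> c into S because the arrow l with x o l in S
    has a section, so that x = (x o l) o h.  The converse extends an arbitrary
    arrow into S by one from [v]. *)
Lemma negneg_coverP (c : C) (S : sieve c) :
  negneg_topology C c S <-> forall x : hom v c, S v x.
Proof.
split=> [Scov x|Sv d f e g nS].
  apply: contrapT => nSx; apply: (Scov v x v (idm v)) => k l Sxl.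
  have [h lh] := split_into_v l.
  by have := sieve_closed h Sxl; rewrite comp_assoc lh !comp_idr.
have [k] := arrow_from_v e.
by apply: (nS v k); apply: Sv.
Qed.

Definition factor_sieve (c : C) : sieve c.
Proof.
refine (@Sieve C c
  (fun d f => exists (x : hom v c) (k : hom d v), f = Defs.comp x k) _).
by move=> d e f g [x [k ->]]; exists x, (Defs.comp k g); rewrite comp_assoc.
Defined.

(** Separation is tested on [factor_sieve c], the least cover of c; agreement on
    it amounts to agreement along the arrows from [v]. *)
Lemma separatedP (F : presheaf C) :
  separated (negneg_topology C) F <->
  forall (c : C) (s t : F c),
    (forall x : hom v c, restr x s = restr x t) -> s = t.
Proof.
split=> [Fsep c s t st|Finj c S /negneg_coverP Sv p s t ps pt]; last first.
  by apply: Finj => x; rewrite (ps _ _ (Sv x)) (pt _ _ (Sv x)).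
have cov : negneg_topology C c (factor_sieve c).
  by apply/negneg_coverP => x; exists x, (idm v); rewrite comp_idr.
pose p := @MatchingFamily C F c (factor_sieve c) (fun _ f _ => restr f s)
  (fun _ _ f g _ _ => restr_comp f g s).
apply: (Fsep c _ cov p) => // d f /= [x [k ->]].
by rewrite !restr_comp st.
Qed.

(** The arrow [idm v] makes the criterion of [separatedP] automatic on
    vertices, which leaves the arcs. *)
Lemma simple_separatedP (a : C) (G : presheaf C) :
  (forall c : C, c = v \/ c = a) ->
  @simple C v a (hom v a) (fun x => x) G <-> separated (negneg_topology C) G.
Proof.
move=> v_or_a; apply: (iff_trans (simpleP _ _)); apply: iff_sym.
apply: (iff_trans (separatedP G)); split=> [Ginj|Ginj c]; first exact: (Ginj a).
case: (v_or_a c) => ->; last exact: Ginj.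
by move=> s t /(_ (idm v)); rewrite !restr_id.
Qed.

End SplitGenerator.

Lemma eq_full_subcategory (C : category) (P Q : C -> Prop) :
  (forall c, P c <-> Q c) -> full_subcategory P = full_subcategory Q.
Proof. by move=> PQ; have -> : P = Q by apply/predeqP. Qed.

Lemma simple_graph_separated (M : monoidType) (X : right_mset M)
    (G : presheaf (theory X)) : inhabited X ->
  simple_graph G <-> separated (negneg_topology (theory X)) G.
Proof.
move=> [x0]; apply: (@simple_separatedP (theory X) V).
- by case; constructor; [exact: tt | exact: x0].
- by case=> [[]|[]]; exists tt.
- by case; [left | right].
Qed.

Lemma simple_rgraph_separated (M : monoidType) (G : presheaf (rtheory M)) :
  (exists m' : M, Fix m') ->
  simple_rgraph G <-> separated (negneg_topology (rtheory M)) G.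
Proof.
move=> [m0 Fm0]; pose x0 : fix_mset M := exist _ m0 Fm0.
apply: (@simple_separatedP (rtheory M) V).
- by case; constructor; [exact: tt | exact: x0].
- by case=> g; [exists tt | exists x0].
- by case; [left | right].
Qed.

Theorem propositionP (M : monoidType) :
  (forall X : right_mset M, inhabited X ->
     @full_subcategory (presheaf_category (theory X)) (@simple_graph M X) =
     @full_subcategory (presheaf_category (theory X))
       (separated (negneg_topology (theory X)))) /\
  ((exists m' : M, Fix m') ->
     @full_subcategory (presheaf_category (rtheory M)) (@simple_rgraph M) =
     @full_subcategory (presheaf_category (rtheory M))
       (separated (negneg_topology (rtheory M)))).
Proof.
split=> [X inhX|FixM]; apply: eq_full_subcategory => G.
  exact: simple_graph_separated.
exact: simple_rgraph_separated.
Qed.
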